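(* Let $X$ be a normed space and let $\varphi_1,\varphi_2:X\to(-\infty,\infty]$ be such that $\varphi_2$ is calm at $\bar x$ and that the function $\varphi(x,y):=\varphi_1(x)+y$, $(x,y)\in X\times\mathbb R$, is finite at $(\bar x,\varphi_2(\bar x))$. Suppose in addition that the sets $C:=\operatorname{epi}\varphi$ and $D:=\operatorname{gph}\varphi_2\times\mathbb R$ in $X\times\mathbb R\times\mathbb R$ satisfy the metric qualification condition $(Q_2)$ with respect to $\widehat\partial$ at $\bar w:=(\bar x,\varphi_2(\bar x),\varphi_1(\bar x)+\varphi_2(\bar x))$, i.e., there exists $a>0$ such that $$\widehat\partial d(\cdot,C\cap D)(\bar w)\subset a\,\widehat\partial d(\cdot,C)(\bar w)+a\,\widehat\partial d(\cdot,D)(\bar w).$$ Then $$\widehat\partial(\varphi_1+\varphi_2)(\bar x)=\widehat\partial\varphi_1(\bar x)+\widehat\partial\varphi_2(\bar x),\qquad\widehat\partial^{\infty}(\varphi_1+\varphi_2)(\bar x)=\widehat\partial^{\infty}\varphi_1(\bar x).$$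
   Context: $X^*$ is the topological dual of $X$; $\mathbb B(\bar x,r)$ is the open ball; product spaces carry the sum norm; $d(z,S)$ is the distance from $z$ to the set $S$. For an extended-real-valued $f$ on $Z$, $\operatorname{epi}f=\{(z,\alpha)\in Z\times\mathbb R\mid\alpha\ge f(z)\}$ and $\operatorname{gph}f=\{(z,\alpha)\in Z\times\mathbb R\mid\alpha=f(z)\}$. Calmness: $f:X\to(-\infty,\infty]$ is calm at $\bar x$ if there are $r>0$, $\ell\ge0$ with $|f(x)-f(\bar x)|\le\ell\|x-\bar x\|$ for all $x\in\mathbb B(\bar x,r)$; in particular $f$ is finite on that ball. Regular subdifferential: for $f$ finite at $\bar z$, $\widehat\partial f(\bar z)$ is the set of $z^*\in Z^*$ such that for every $\varepsilon>0$ there is $\gamma>0$ with $f(z)-f(\bar z)-\langle z^*,z-\bar z\rangle\ge-\varepsilon\|z-\bar z\|$ for all $z\in\mathbb B(\bar z,\gamma)$. Regular normal cone: for $S\subset Z$ and $\bar z\in S$, $\widehat N(\bar z;S)=\{z^*\in Z^*\mid \limsup_{z\to\bar z,\,z\in S}\langle z^*,\frac{z-\bar z}{\|z-\bar z\|}\rangle\le0\}$. Singular regular subdifferential: $\widehat\partial^{\infty}f(\bar z)=\{z^*\in Z^*\mid(z^*,0)\in\widehat N((\bar z,f(\bar z));\operatorname{epi}f)\}$. *)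

(* Defs.v *)
From HB Require Import structures.
From mathcomp Require Import all_boot all_order all_algebra.
From mathcomp Require Import all_classical all_reals all_analysis.

Set Implicit Arguments.
Unset Strict Implicit.
Unset Printing Implicit Defensive.

Import Order.TTheory GRing.Theory Num.Theory.
Import numFieldNormedType.Exports.

Local Open Scope classical_set_scope.
Local Open Scope ring_scope.

(* The library norms a product of normed modules with the max norm, on which
   the distance functions below would depend. This alias carries the norm
   `|w.1| + `|w.2| and the metric and topology induced by it. *)
Definition sumprod {R : realType} (X Y : normedModType R) : Type :=
  (X * Y)%type.

Section sumprod_norm.
Context {R : realType} (X Y : normedModType R).

HB.instance Definition _ := GRing.Lmodule.copy (sumprod X Y) (X * Y)%type.

Let sumnorm (w : sumprod X Y) : R := `|w.1| + `|w.2|.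

Let ler_sumnormD (u v : sumprod X Y) : sumnorm (u + v) <= sumnorm u + sumnorm v.
Proof. by rewrite /sumnorm addrACA lerD// ler_normD. Qed.

Let sumnormZ (l : R) (u : sumprod X Y) : sumnorm (l *: u) = `|l| * sumnorm u.
Proof. by rewrite /sumnorm !normrZ mulrDr. Qed.

Let sumnorm0_eq0 (u : sumprod X Y) : sumnorm u = 0 -> u = 0.
Proof.
case: u => x y /eqP; rewrite /sumnorm paddr_eq0//= !normr_eq0.
by move=> /andP[/eqP -> /eqP ->].
Qed.

HB.instance Definition _ := Lmodule_isNormed.Build R (sumprod X Y)
  ler_sumnormD sumnormZ sumnorm0_eq0.

Lemma sumprod_normE (w : sumprod X Y) : `|w| = `|w.1| + `|w.2|.
Proof. by []. Qed.

End sumprod_norm.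

Section variational.
Context {R : realType}.
Implicit Types Z : normedModType R.

Definition dual Z : set (Z -> R^o) := [set zs | linear zs /\ continuous zs].

Definition epi Z (f : Z -> \bar R) : set (sumprod Z R^o) :=
  [set w | (f w.1 <= w.2%:E)%E].

Definition gph Z (f : Z -> \bar R) : set (sumprod Z R^o) :=
  [set w | w.2%:E = f w.1].

(* Since oo - oo = -oo, the inequality fails at x = xbar if f xbar is infinite;
   otherwise it fails wherever f x is. So f is finite on the whole ball. *)
Definition calm Z (f : Z -> \bar R) (xbar : Z) : Prop :=
  exists r l : R, [/\ 0 < r, 0 <= l &
    forall x, ball xbar r x ->
      (`|f x - f xbar| <= (l * `|x - xbar|)%:E)%E].

Definition regular_subdiff Z (f : Z -> \bar R) (zbar : Z) : set (Z -> R^o) :=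
  [set zs | dual zs /\ forall eps : R, 0 < eps -> exists2 gamma : R, 0 < gamma &
    forall z, ball zbar gamma z ->
      ((- eps * `|z - zbar|)%:E <= f z - f zbar - (zs (z - zbar))%:E)%E].

(* The upper limit is taken over z in S distinct from zbar; it is -oo, hence
   <= 0, if zbar is isolated in S. *)
Definition regular_normal Z (zbar : Z) (S : set Z) : set (Z -> R^o) :=
  [set zs | dual zs /\
    (limf_esup (fun z => (zs (`|z - zbar|^-1 *: (z - zbar)))%:E)
       (within S zbar^') <= 0)%E].

Definition singular_regular_subdiff Z (f : Z -> \bar R) (zbar : Z) :
    set (Z -> R^o) :=
  [set zs | dual zs /\
    regular_normal ((zbar, fine (f zbar)) : sumprod Z R^o) (epi f)
      (fun w => zs w.1 + 0 * w.2)].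

Definition metric_qualification Z (C D : set Z) (wbar : Z) : Prop :=
  exists2 a : R, 0 < a &
    regular_subdiff (edist_inf (C `&` D)) wbar `<=`
    [set a *: u + a *: v | u in regular_subdiff (edist_inf C) wbar
                         & v in regular_subdiff (edist_inf D) wbar].

End variational.

(* Main.v *)
From HB Require Import structures.
Require Import Defs.
From mathcomp Require Import all_boot all_order all_algebra.
From mathcomp Require Import all_classical all_reals all_analysis.
From mathcomp Require Import lra.
Import Order.TTheory GRing.Theory Num.Theory.
Import numFieldNormedType.Exports.
Local Open Scope classical_set_scope.
Local Open Scope ring_scope.
Set Implicit Arguments.
Unset Strict Implicit.
Unset Printing Implicit Defensive.

(** If (zs, k) is a regular normal to epi (phi1 + phi2), then (zs, 0, k) is one
to C `&` D. A regular normal to a set is, up to a positive factor, a regular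
subgradient of the distance to the set, so the metric qualification condition
splits (zs, 0, k) into regular normals to C and D. As C contains the line
through the base point in the direction (0, 1, 1), and D the one in the
direction (0, 0, 1), these are (u, - k, k) and (v, k, 0), and they give the
normals (u, k) to epi phi1 and (v, k) to gph phi2. For k = -1 the first is a
subgradient of phi1 and, by calmness, the second is one of phi2; for k = 0
calmness forces v = 0. The reverse inclusions are direct. *)

(** * Continuous linear functionals *)

Section dual.
Context {R : realType}.
Implicit Types Z : normedModType R.

(** [dual] records linearity as a bare property; packing it as a structure gives access to the
    rewriting rules for linear maps. *)
Lemma linear_repr Z (zs : Z -> R^o) :
  linear zs -> exists f : {linear Z -> R^o}, zs = f.
Proof.
move=> lzs; pose m := GRing.isLinear.Build _ _ _ _ zs lzs.
by exists (HB.pack zs m : {linear Z -> R^o}).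
Qed.

(** Continuity is traded for a norm bound; [L] is taken positive so that it can be divided by. *)
Lemma dualP Z (zs : Z -> R^o) : dual zs <->
  linear zs /\ exists2 L : R, 0 < L & forall z, `|zs z| <= L * `|z|.
Proof.
split=> -[/[dup] lzs /linear_repr[f fE]]; rewrite {}fE in lzs *.
  move=> cf; split=> //.
  have /linear_bounded_continuous/linear_boundedP/pinfty_ex_gt0[L L0 fL] := cf.
  by exists L.
case=> L L0 fL; split=> //.
apply/linear_bounded_continuous/linear_boundedP.
exists L; split; first exact: gtr0_real.
by move=> l Ll z; rewrite (le_trans (fL z))// ler_wpM2r// ltW.
Qed.

Lemma dualD Z (u v : Z -> R^o) : dual u -> dual v -> dual (u + v).
Proof.
move=> /dualP[lu [k k0 uk]] /dualP[lv [l l0 vl]]; apply/dualP; split.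
  by move=> t x y; rewrite !fctE lu lv /= scalerDr addrACA.
exists (k + l); first exact: addr_gt0.
by move=> z; rewrite (le_trans (ler_normD _ _))// mulrDl lerD.
Qed.

Lemma dualZ Z (u : Z -> R^o) (a : R) : 0 < a -> dual u -> dual (a *: u).
Proof.
move=> a0 /dualP[lu [k k0 uk]]; apply/dualP; split.
  move=> t x y; rewrite !fctE lu /= scalerDr; congr (_ + _).
  by rewrite !scalerA mulrC.
exists (a * k); first exact: mulr_gt0.
by move=> z; rewrite !fctE normrZ gtr0_norm// -mulrA ler_pM2l.
Qed.

Lemma dual_pair Z (u : Z -> R^o) (c : R) :
  dual (fun w : sumprod Z R^o => u w.1 + c * w.2) <-> dual u.
Proof.
split=> [/dualP[lu [k k0 uk]]|/dualP[lu [k k0 uk]]]; apply/dualP; split.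
- by move=> t x y; have /= := lu t (x, 0) (y, 0); rewrite !scaler0 !addr0 mulr0 !addr0.
- exists k => // x; have := uk (x, 0); rewrite sumprod_normE/=.
  by rewrite normr0 mulr0 !addr0.
- move=> t x y /=; rewrite lu.
  change (t * u x.1 + u y.1 + c * (t * x.2 + y.2) = t * (u x.1 + c * x.2) + (u y.1 + c * y.2)).
  lra.
- exists (k + `|c|); first by rewrite ltr_wpDr.
  move=> w; rewrite sumprod_normE (le_trans (ler_normD _ _))// normrM.
  have := uk w.1; have : 0 <= k * `|w.2 : R| by rewrite mulr_ge0// ltW.
  have : 0 <= `|c| * `|w.1| by rewrite mulr_ge0.
  lra.
Qed.

End dual.

(** * Epsilon-delta forms of regular normals and subgradients *)

Section normal.
Context {R : realType}.
Implicit Types Z : normedModType R.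

Lemma ball_distE Z (x y : Z) (r : R) : ball x r y = (`|y - x| < r) :> Prop.
Proof. by rewrite -ball_normE /ball_/= distrC. Qed.

Lemma regular_normalP Z (zbar : Z) (S : set Z) (zs : Z -> R^o) :
  regular_normal zbar S zs <->
  dual zs /\ forall eps : R, 0 < eps -> exists2 g : R, 0 < g &
    forall z, `|z - zbar| < g -> S z -> zs (z - zbar) <= eps * `|z - zbar|.
Proof.
split=> -[dzs zsS]; split=> //.
- have [f fE] := linear_repr dzs.1; rewrite {}fE in dzs zsS *.
  move=> eps eps0.
  have : (limf_esup (fun z => (f (`|z - zbar|^-1 *: (z - zbar)))%:E)
       (within S zbar^') < eps%:E)%E by rewrite (le_lt_trans zsS)// lte_fin.
  rewrite limf_esupE => /ereal_inf_lt[_ [A /nbhs_ballP[/= g g0 gA] <-]] Aeps.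
  exists g => // z zg Sz.
  have [->|zneq] := eqVneq z zbar; first by rewrite subrr linear0 normr0 mulr0.
  have n0 : 0 < `|z - zbar| by rewrite normr_gt0 subr_eq0.
  have : ((f (`|z - zbar|^-1 *: (z - zbar)))%:E <= eps%:E)%E.
    apply: le_trans (ltW Aeps); apply: ereal_sup_ubound; exists z => //.
    by apply: gA => //; rewrite ball_distE.
  by rewrite lee_fin linearZ/= ler_pdivrMl// mulrC.
- have [f fE] := linear_repr dzs.1; rewrite {}fE in dzs zsS *.
  apply/lee_addgt0Pr => eps eps0; rewrite add0e.
  have [g g0 gS] := zsS _ eps0.
  rewrite limf_esupE.
  apply: (@le_trans _ _ (ereal_sup ((fun z => (f (`|z - zbar|^-1 *: (z - zbar)))%:E) @`
      [set z | `|z - zbar| < g /\ z != zbar /\ S z]))).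
    apply: ereal_inf_lbound; exists [set z | `|z - zbar| < g /\ z != zbar /\ S z] => //.
    apply/nbhs_ballP; exists g => //= z; rewrite ball_distE => zg zneq Sz.
    by [].
  apply: ge_ereal_sup => _ [z [zg [zneq Sz]] <-].
  have n0 : 0 < `|z - zbar| by rewrite normr_gt0 subr_eq0.
  rewrite lee_fin linearZ/= ler_pdivrMl// mulrC.
  exact: gS.
Qed.

(** With the finite value [c] named, all real terms move to one side and no subtraction of extended
    reals is left. *)
Lemma regular_subdiffP Z (f : Z -> \bar R) (zbar : Z) (c : R) (zs : Z -> R^o) :
  f zbar = c%:E ->
  regular_subdiff f zbar zs <->
  dual zs /\ forall eps : R, 0 < eps -> exists2 g : R, 0 < g &
    forall z, `|z - zbar| < g ->
      ((c + zs (z - zbar) - eps * `|z - zbar|)%:E <= f z)%E.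
Proof.
move=> fc.
have E eps z : ((- eps * `|z - zbar|)%:E <= f z - f zbar - (zs (z - zbar))%:E)%E
    = ((c + zs (z - zbar) - eps * `|z - zbar|)%:E <= f z)%E.
  rewrite fc; case: (f z) => [r| |]; rewrite /= ?leey//.
  by rewrite -!EFinB !lee_fin; apply/idP/idP; lra.
split=> -[dzs H]; split=> // eps eps0; have [g g0 gH] := H _ eps0;
    exists g => // z.
  by move=> zg; rewrite -E; apply: gH; rewrite ball_distE.
by rewrite ball_distE E; exact: gH.
Qed.

Lemma edist_normE_le Z (z p : Z) : ((`|z - p|)%:E <= edist (z, p))%E.
Proof.
apply: le_ereal_inf_tmp => _ [r [_ /= zpr] <-].
by rewrite lee_fin distrC ltW// -ball_distE.
Qed.

Lemma regular_normal_scale Z (zbar : Z) (S : set Z) (zs : Z -> R^o) (a : R) :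
  0 < a -> regular_normal zbar S zs -> regular_normal zbar S (a *: zs).
Proof.
move=> a0 /regular_normalP[dzs zsS]; apply/regular_normalP; split.
  exact: dualZ.
move=> eps eps0; have [g g0 gS] := zsS _ (divr_gt0 eps0 a0).
exists g => // z zg Sz; rewrite fctE /= -ler_pdivlMl// mulrA [_^-1 * _]mulrC.
exact: gS.
Qed.

(** * Regular normals and the distance function *)

Lemma regular_subdiff_edist_inf_normal Z (zbar : Z) (S : set Z) :
  S zbar ->
  regular_subdiff (edist_inf S) zbar `<=` regular_normal zbar S.
Proof.
move=> Szbar zs /(regular_subdiffP _ (edist_inf0 Szbar))[dzs zsS].
apply/regular_normalP; split=> // eps eps0; have [g g0 gS] := zsS _ eps0.
exists g => // z zg Sz; have := gS _ zg; rewrite edist_inf0// lee_fin; lra.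
Qed.

(** The distance is 1-Lipschitz, so its subgradients have norm at most 1; the factor [k] scales the
    normal into the unit ball. *)
Lemma regular_normal_subdiff_edist_inf Z (zbar : Z) (S : set Z) (zs : Z -> R^o) :
  S zbar -> regular_normal zbar S zs ->
  exists2 k : R, 0 < k & regular_subdiff (edist_inf S) zbar (k *: zs).
Proof.
move=> Szbar /[dup] zsN /regular_normalP[/dualP[_ [L L0 zsL]] _].
exists L^-1; rewrite ?invr_gt0//.
have L1 : 0 < L^-1 by rewrite invr_gt0.
have := regular_normal_scale L1 zsN.
have : forall z, `|(L^-1 *: zs) z| <= `|z|.
  by move=> z; rewrite fctE normrZ gtr0_norm// ler_pdivrMl.
move: (L^-1 *: zs) => {}zs {zsN L L0 zsL L1} zs1 /regular_normalP[dzs zsS].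
apply/(regular_subdiffP _ (edist_inf0 Szbar)); split=> // eps eps0.
(* Both halvings, of [eps] and of [g], compensate the factor 2 in the estimate of [|p - zbar|] by
   [|z - zbar|]. *)
have eps20 : 0 < eps / 2 by lra.
have [g g0 gS] := zsS _ eps20.
exists (g / 2); first by lra.
move=> z zg; apply: le_ereal_inf_tmp => _ [p Sp <-].
apply: le_trans (edist_normE_le _ _); rewrite lee_fin.
(* Far from p the bound |zs| <= 1 suffices; otherwise |p - zbar| <= 2 |z - zbar|
   and the normality of zs applies at p. *)
have [zp|zp] := lerP `|z - zbar| `|z - p|.
  have := zs1 (z - zbar); have := ler_norm (zs (z - zbar)).
  have : 0 <= eps * `|z - zbar| by rewrite mulr_ge0// ltW.
  lra.
have pz : `|p - zbar| <= `|z - p| + `|z - zbar|.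
  by rewrite (le_trans (ler_distD z _ _))// [`|p - z|]distrC.
have pg : `|p - zbar| < g by lra.
have := gS _ pg Sp.
have [f fE] := linear_repr dzs.1; rewrite {}fE in dzs zsS zs1 gS *.
have -> : z - zbar = (z - p) + (p - zbar) by rewrite addrA subrK.
rewrite [f (_ + _)]linearD /=.
have -> : (z - p) + (p - zbar) = z - zbar by rewrite addrA subrK.
have := zs1 (z - p); have := ler_norm (f (z - p)).
have : eps / 2 * `|p - zbar| <= eps / 2 * (2 * `|z - zbar|).
  by rewrite ler_pM2l//; lra.
lra.
Qed.

(** Subgradients of the distances are normals, and normals form cones, so the factors [a] and [k^-1]
    are absorbed. *)
Lemma metric_qualification_normal Z (C D : set Z) (wbar : Z) (ws : Z -> R^o) :
  C wbar -> D wbar -> metric_qualification C D wbar ->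
  regular_normal wbar (C `&` D) ws ->
  exists u v, [/\ regular_normal wbar C u, regular_normal wbar D v &
    ws = u + v].
Proof.
move=> Cw Dw [a a0 qual] /(regular_normal_subdiff_edist_inf (conj Cw Dw))[k k0].
move=> /qual[u uC [v vD uvE]].
exists (k^-1 *: (a *: u)), (k^-1 *: (a *: v)); split.
- apply: regular_normal_scale; first by rewrite invr_gt0.
  exact/regular_normal_scale/regular_subdiff_edist_inf_normal.
- apply: regular_normal_scale; first by rewrite invr_gt0.
  exact/regular_normal_scale/regular_subdiff_edist_inf_normal.
- by rewrite -scalerDr uvE scalerA mulVf ?gt_eqF// scale1r.
Qed.

(** Normality at [zbar + t *: h] and [zbar - t *: h] bounds both [zs h] and its opposite by
    arbitrarily small numbers. *)
Lemma regular_normal_line Z (zbar h : Z) (S : set Z) (zs : Z -> R^o) :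
  (forall t : R, S (zbar + t *: h)) -> regular_normal zbar S zs -> zs h = 0.
Proof.
move=> Sh /regular_normalP[dzs zsS].
have [f fE] := linear_repr dzs.1; rewrite {}fE in dzs zsS *.
have [->|h0] := eqVneq h 0; first by rewrite linear0.
have n0 : 0 < `|h| by rewrite normr_gt0.
apply/eqP; rewrite -normr_le0; apply/ler_addgt0Pr => e e0; rewrite add0r.
have [g g0 gS] := zsS _ (divr_gt0 e0 n0).
have [t t0 thg] : exists2 t : R, 0 < t & t * `|h| < g.
  by exists (g / 2 / `|h|); rewrite ?divr_gt0// divfK ?gt_eqF//; lra.
have tg s : `|s| = t -> f h * s <= e * t.
  move=> st; have sE : zbar + s *: h - zbar = s *: h by rewrite addrC addKr.
  have sg : `|s *: h| < g by rewrite normrZ st.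
  have := gS (zbar + s *: h).
  rewrite sE linearZ/= => /(_ sg (Sh s)).
  rewrite normrZ st [t * _]mulrC mulrA divfK ?gt_eqF//.
  by rewrite [X in X <= _]mulrC.
rewrite ler_norml -(ler_pM2r t0) -[f h <= _](ler_pM2r t0) (tg t) ?gtr0_norm//.
by rewrite andbT mulNr lerNl -mulrN tg// normrN gtr0_norm.
Qed.

Lemma regular_normal_setT Z (zbar : Z) (zs : Z -> R^o) :
  regular_normal zbar setT zs -> zs = 0.
Proof.
by move=> zsT; apply/funext => h; apply: regular_normal_line zsT.
Qed.

(** * Normals to epigraphs and graphs *)

Lemma regular_normal_pairP Z (zbar : Z) (abar c : R) (S : set (sumprod Z R^o))
    (zs : Z -> R^o) :
  regular_normal ((zbar, abar) : sumprod Z R^o) S (fun w => zs w.1 + c * w.2)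
  <-> dual zs /\ forall eps : R, 0 < eps -> exists2 g : R, 0 < g &
    forall z a, `|z - zbar| + `|a - abar| < g -> S (z, a) ->
      zs (z - zbar) + c * (a - abar) <= eps * (`|z - zbar| + `|a - abar|).
Proof.
split=> [/regular_normalP[/dual_pair dzs H]|[dzs H]].
  split=> // eps eps0; have [g g0 gH] := H _ eps0; exists g => // z a.
  exact: (gH (z, a)).
apply/regular_normalP; split; first exact/dual_pair.
move=> eps eps0; have [g g0 gH] := H _ eps0; exists g => // -[z a].
exact: gH.
Qed.

(** From normals to subgradients, [f z] may be far below [c], so normality is tested not at
    [(z, f z)] but at a higher point whose distance to [(zbar, c)] is controlled. *)
Lemma regular_normal_epi_subdiff Z (f : Z -> \bar R) (zbar : Z) (c : R)
    (zs : Z -> R^o) :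
  f zbar = c%:E ->
  regular_normal ((zbar, c) : sumprod Z R^o) (epi f)
    (fun w => zs w.1 + -1 * w.2) <-> regular_subdiff f zbar zs.
Proof.
move=> fc; split.
  move=> /regular_normal_pairP[dzs zsS]; apply/(regular_subdiffP _ fc).
  split=> // eps eps0.
  have /dualP[_ [L L0 zsL]] := dzs.
  (* The test point will lie within [(1 + L + eps) * |z - zbar|] of [(zbar, c)]; dividing by this
     constant leaves an error of [eps / 2 * |z - zbar|], against a left-hand side equal to
     [eps * |z - zbar|]. *)
  have M0 : 0 < 1 + L + eps by lra.
  have e20 : 0 < eps / 2 / (1 + L + eps) by rewrite !divr_gt0.
  have [g g0 gS] := zsS _ e20.
  exists (g / (1 + L + eps)); first exact: divr_gt0.
  move=> z; rewrite ltr_pdivlMr// => zg.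
  rewrite leNgt; apply/negP => fz.
  (* Otherwise (z, a) below lies in the epigraph, within O(|z - zbar|). *)
  have [zE|zneq] := eqVneq z zbar.
    move: fz; have [k kE] := linear_repr dzs.1.
    by rewrite zE kE subrr linear0 normr0 mulr0 subr0 addr0 fc ltxx.
  have n0 : 0 < `|z - zbar| by rewrite normr_gt0 subr_eq0.
  pose a := c + zs (z - zbar) - eps * `|z - zbar|.
  have aL : `|a - c| <= (L + eps) * `|z - zbar|.
    have -> : a - c = zs (z - zbar) - eps * `|z - zbar| by rewrite /a; lra.
    rewrite (le_trans (ler_normB _ _))// normrM normr_id gtr0_norm// mulrDl.
    by rewrite lerD2r.
  have aS : epi f (z, a) by exact: ltW.
  have ag : `|z - zbar| + `|a - c| < g by lra.
  have := gS _ _ ag aS.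
  have : eps / 2 / (1 + L + eps) * (`|z - zbar| + `|a - c|) <= eps / 2 * `|z - zbar|.
    rewrite -mulrA ler_pM2l; last by lra.
    by rewrite ler_pdivrMl//; lra.
  have : 0 < eps * `|z - zbar| by rewrite mulr_gt0.
  rewrite /a; lra.
move=> /(regular_subdiffP _ fc)[dzs zsS]; apply/regular_normal_pairP.
split=> // eps eps0; have [g g0 gS] := zsS _ eps0; exists g => // z a zag fza.
have zg : `|z - zbar| < g by rewrite (le_lt_trans _ zag)// lerDl.
have := le_trans (gS _ zg) fza; rewrite lee_fin/=.
have : 0 <= eps * `|a - c| by rewrite mulr_ge0// ltW.
lra.
Qed.

(** Calmness is read at [zbar] itself, where an infinite value would make the left-hand side
    infinite. *)
Lemma calm_fin_num Z (f : Z -> \bar R) zbar : calm f zbar -> f zbar \is a fin_num.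
Proof.
move=> [r [l [r0 l0 /(_ zbar)]]]; rewrite ball_distE subrr normr0 mulr0.
by case: (f zbar) => //= /(_ r0).
Qed.

Lemma calm_dist Z (f : Z -> \bar R) zbar c : calm f zbar -> f zbar = c%:E ->
  exists r l : R, [/\ 0 < r, 0 <= l & forall z, `|z - zbar| < r ->
    exists2 y : R, f z = y%:E & `|y - c| <= l * `|z - zbar|].
Proof.
move=> [r [l [r0 l0 H]]] fc; exists r, l; split=> // z.
rewrite -ball_distE => /H; rewrite fc.
case: (f z) => [y| |] //=.
by rewrite lee_fin => ?; exists y.
Qed.

(** By calmness a graph point over [z] is within [(1 + l) * |z - zbar|] of [(zbar, c)], so the error
    can be measured by [|z - zbar|] alone. *)
Lemma regular_normal_gph Z (f : Z -> \bar R) zbar c k (v : Z -> R^o) :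
  calm f zbar -> f zbar = c%:E ->
  regular_normal ((zbar, c) : sumprod Z R^o) (gph f) (fun w => v w.1 + k * w.2) ->
  dual v /\ forall eps : R, 0 < eps -> exists2 g : R, 0 < g &
    forall z, `|z - zbar| < g ->  exists2 y : R, f z = y%:E &
      v (z - zbar) + k * (y - c) <= eps * `|z - zbar|.
Proof.
move=> fcalm fc /regular_normal_pairP[dv vS]; split=> // eps eps0.
have [r [l [r0 l0 fl]]] := calm_dist fcalm fc.
have l1 : 0 < 1 + l by lra.
have [g g0 gS] := vS _ (divr_gt0 eps0 l1).
exists (Num.min r (g / (1 + l))); first by rewrite lt_min r0 divr_gt0.
move=> z; rewrite lt_min ltr_pdivlMr// => /andP[/fl[y fy yl] zg].
exists y => //; have zyg : `|z - zbar| + `|y - c| < g by lra.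
rewrite (le_trans (gS _ _ zyg _))//.
by rewrite -mulrA ler_pM2l// ler_pdivrMl//; lra.
Qed.

End normal.

(** * Splitting and adding normals for the sum *)

Section sum.
Context {R : realType} (X : normedModType R) (phi1 phi2 : X -> \bar R).
Context (xbar : X) (c1 c2 : R).
Context (phi1c : phi1 xbar = c1%:E) (phi2c : phi2 xbar = c2%:E).
Context (phi2_calm : calm phi2 xbar).
Let phi : sumprod X R^o -> \bar R := fun p => (phi1 p.1 + p.2%:E)%E.
Let C : set (sumprod (sumprod X R^o) R^o) := epi phi.
Let D : set (sumprod (sumprod X R^o) R^o) := gph phi2 `*` setT.
Let wbar : sumprod (sumprod X R^o) R^o := ((xbar, c2), c1 + c2).

(* The case k = -1 is about regular subdifferentials, the case k = 0 about
   singular ones. *)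
Lemma regular_normal_epi_sum (k : R) (zs : X -> R^o) :
  metric_qualification C D wbar ->
  regular_normal ((xbar, c1 + c2) : sumprod X R^o) (epi (phi1 \+ phi2)%E)
    (fun w => zs w.1 + k * w.2) ->
  exists u v, [/\ regular_normal ((xbar, c1) : sumprod X R^o) (epi phi1)
      (fun w => u w.1 + k * w.2),
    regular_normal ((xbar, c2) : sumprod X R^o) (gph phi2)
      (fun w => v w.1 + k * w.2) & zs = u + v].
Proof.
move=> qual /regular_normal_pairP[dzs zsS].
have Cw : C wbar by rewrite /C /epi /= /phi /= phi1c.
have Dw : D wbar by rewrite /D /gph /= phi2c.
have : regular_normal wbar (C `&` D) (fun w => (zs w.1.1 + 0 * w.1.2) + k * w.2).
  apply: (@regular_normal_pairP R (sumprod X R^o) (xbar, c2) (c1 + c2) k (C `&` D)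
    (fun p => zs p.1 + 0 * p.2)).2.
  split; first exact/dual_pair.
  move=> eps eps0; have [g g0 gS] := zsS _ eps0; exists g => //.
  (* On the intersection [y] is [phi2 x], so dropping [y] gives a point of the epigraph of the sum,
     no farther from the base point. *)
  move=> [x y] a; rewrite sumprod_normE/= mul0r addr0 => xyag [].
  rewrite /C /D /epi /gph/= /phi /= => Cxya [yE _].
  have xag : `|x - xbar| + `|a - (c1 + c2)| < g.
    by apply: le_lt_trans xyag; rewrite lerD2r lerDl.
  have xaS : epi (phi1 \+ phi2)%E (x, a) by rewrite /epi /= -yE.
  rewrite (le_trans (gS _ _ xag xaS))// ler_pM2l// lerD2r lerDl.
  exact: normr_ge0.
move=> /(metric_qualification_normal Cw Dw qual)[u [v [uC vD uvE]]].
have du : dual u by case/regular_normalP: uC.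
have dv : dual v by case/regular_normalP: vD.
have [f fE] := linear_repr du.1; have [h hE] := linear_repr dv.1.
pose e1 x : sumprod (sumprod X R^o) R^o := ((x, 0), 0).
pose e2 : sumprod (sumprod X R^o) R^o := ((0, 1), 0).
pose e3 : sumprod (sumprod X R^o) R^o := ((0, 0), 1).
have decomp (x : X) (y a : R) :
    ((x, y), a) = e1 x + y *: e2 + a *: e3 :> sumprod (sumprod X R^o) R^o.
  rewrite /e1 /e2 /e3; congr ((_, _), _) => /=.
  - by rewrite !scaler0 !addr0.
  - by rewrite scaler0 addr0 add0r; exact/esym/mulr1.
  - by rewrite scaler0 !add0r; exact/esym/mulr1.
(* D is invariant along (0, 0, 1), and C along (0, 1, 1): this determines the
   real components of u and v. *)
have v3 : v e3 = 0.
  apply: (regular_normal_line _ vD) => t; split=> //=.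
  by rewrite /gph/= scaler0 scaler0 !addr0 phi2c.
have u23 : u (e2 + e3) = 0.
  apply: (regular_normal_line _ uC) => t.
  rewrite /C /epi /phi /= !(addr0, scaler0) phi1c lee_fin add0r.
  by rewrite /GRing.scale/=; lra.
have u3 : u e3 = k.
  have := congr1 (fun F => F e3) uvE; rewrite /= fctE v3 addr0 => <-.
  have [j ->] := linear_repr dzs.1.
  by rewrite linear0; lra.
have u2 : u e2 = - k.
  by move: u23; rewrite -u3 fE linearD /= => /eqP; rewrite addr_eq0 => /eqP.
have v2 : v e2 = k.
  have := congr1 (fun F => F e2) uvE; rewrite /= fctE u2.
  have [j ->] := linear_repr dzs.1.
  by rewrite linear0; lra.
have uE x (y a : R) : u ((x, y), a) = u (e1 x) - k * y + k * a.
  rewrite decomp -u3 {1 2}fE 2!linearD 2!linearZ/= -fE u2 u3.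
  by rewrite /GRing.scale/=; lra.
have vE x (y a : R) : v ((x, y), a) = v (e1 x) + k * y.
  rewrite decomp {1}hE 2!linearD 2!linearZ/= -hE v2 v3.
  by rewrite /GRing.scale/=; lra.
have e1D t x y : e1 (t *: x + y) = t *: e1 x + e1 y.
  by rewrite /e1; congr ((_, _), _) => /=; rewrite scaler0 addr0.
have e1n x : `|e1 x| = `|x| by rewrite !sumprod_normE/= normr0 !addr0.
have de1 w : dual w -> dual (w \o e1).
  move=> /dualP[lw [L L0 wL]]; apply/dualP; split.
    by move=> t x y /=; rewrite e1D lw.
  by exists L => // x; rewrite -e1n /=; exact: wL.
exists (u \o e1), (v \o e1); split.
- apply/regular_normal_pairP; split; first exact: de1.
  move=> eps eps0; have /regular_normalP[_ /(_ _ eps0)[g g0 gS]] := uC.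
  exists g => // x a xag epixa.
  (* A point [(x, a)] of the epigraph of [phi1] is lifted to C with middle coordinate frozen at
     [c2]; its distance to the base point is unchanged. *)
  have dE : ((x, c2), a + c2) - wbar = ((x - xbar, 0), a - c1)
      :> sumprod (sumprod X R^o) R^o.
    congr ((_, _), _); first exact: subrr.
    by rewrite /= opprD addrACA subrr addr0.
  have := gS ((x, c2), a + c2).
  rewrite dE !sumprod_normE/= normr0 addr0 => /(_ xag).
  rewrite uE mulr0 subr0; apply.
  by rewrite /C/epi/phi/= EFinD leeD2r.
- apply/regular_normal_pairP; split; first exact: de1.
  move=> eps eps0; have /regular_normalP[_ /(_ _ eps0)[g g0 gS]] := vD.
  exists g => // x a xag gphxa.
  (* The last coordinate is free in D, so it is kept at its base value. *)
  have dE : ((x, a), c1 + c2) - wbar = ((x - xbar, a - c2), 0)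
      :> sumprod (sumprod X R^o) R^o.
    by congr ((_, _), _); exact: subrr.
  have := gS ((x, a), c1 + c2).
  rewrite dE !sumprod_normE/= normr0 addr0 => /(_ xag).
  by rewrite vE; apply.
- apply/funext => x; have := congr1 (fun F => F (e1 x)) uvE.
  by rewrite /= !mulr0 !addr0.
Qed.

Lemma regular_subdiffD (u v : X -> R^o) : regular_subdiff phi1 xbar u ->
  regular_subdiff phi2 xbar v -> regular_subdiff (phi1 \+ phi2)%E xbar (u + v).
Proof.
move=> /(regular_subdiffP _ phi1c)[du uS] /(regular_subdiffP _ phi2c)[dv vS].
have phic : (phi1 \+ phi2)%E xbar = (c1 + c2)%:E by rewrite /= phi1c phi2c.
apply/(regular_subdiffP _ phic); split; first exact: dualD.
move=> eps eps0; have e20 : 0 < eps / 2 by lra.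
have [g1 g10 g1S] := uS _ e20; have [g2 g20 g2S] := vS _ e20.
exists (Num.min g1 g2); first by rewrite lt_min g10.
move=> x; rewrite lt_min => /andP[/g1S h1 /g2S h2].
apply: le_trans (leeD h1 h2); rewrite -EFinD lee_fin fctE; lra.
Qed.

(** Subtracting [phi2 x] from the height moves a point of the epigraph of the sum into that of
    [phi1]; calmness bounds the change of height relative to [c2] by [l * |x - xbar|]. *)
Lemma singular_regular_normal_epi_sum (zs : X -> R^o) :
  regular_normal ((xbar, c1) : sumprod X R^o) (epi phi1)
    (fun w => zs w.1 + 0 * w.2) ->
  regular_normal ((xbar, c1 + c2) : sumprod X R^o) (epi (phi1 \+ phi2)%E)
    (fun w => zs w.1 + 0 * w.2).
Proof.
move=> /regular_normal_pairP[dzs zsS]; apply/regular_normal_pairP.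
split=> // eps eps0; have [r [l [r0 l0 phi2l]]] := calm_dist phi2_calm phi2c.
have l1 : 0 < 1 + l by lra.
have [g g0 gS] := zsS _ (divr_gt0 eps0 l1).
exists (Num.min r (g / (1 + l))); first by rewrite lt_min r0 divr_gt0.
move=> x a; rewrite lt_min ltr_pdivlMr// => /andP[xar xag].
have xr : `|x - xbar| < r by rewrite (le_lt_trans _ xar)// lerDl.
have [y phi2x yl] := phi2l _ xr.
rewrite /epi/= phi2x -leeBrDr// -EFinB => phi1x.
have ayl : `|a - y - c1| <= `|a - (c1 + c2)| + l * `|x - xbar|.
  have -> : a - y - c1 = a - (c1 + c2) - (y - c2) by lra.
  by rewrite (le_trans (ler_normB _ _))// lerD2l.
have la : 0 <= l * `|a - (c1 + c2)| by rewrite mulr_ge0.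
have xyg : `|x - xbar| + `|a - y - c1| < g by lra.
have := gS _ _ xyg phi1x; rewrite !mul0r => /le_trans; apply.
by rewrite -mulrA ler_pM2l// ler_pdivrMl//; lra.
Qed.

End sum.

(** * The two sum rules *)

Theorem theorem5p3 (R : realType) (X : normedModType R)
    (phi1 phi2 : X -> \bar R) (xbar : X)
    (phi1_neqNy : forall x, phi1 x != -oo%E)
    (phi2_neqNy : forall x, phi2 x != -oo%E)
    (phi2_calm : calm phi2 xbar) :
  let phi : sumprod X R^o -> \bar R := fun p => (phi1 p.1 + p.2%:E)%E in
  let C : set (sumprod (sumprod X R^o) R^o) := epi phi in
  let D : set (sumprod (sumprod X R^o) R^o) := gph phi2 `*` setT in
  let wbar : sumprod (sumprod X R^o) R^o :=
    ((xbar, fine (phi2 xbar)), fine (phi1 xbar + phi2 xbar)%E) in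
  phi (xbar, fine (phi2 xbar)) \is a fin_num ->
  metric_qualification C D wbar ->
  regular_subdiff (phi1 \+ phi2)%E xbar =
    [set u + v | u in regular_subdiff phi1 xbar
               & v in regular_subdiff phi2 xbar] /\
  singular_regular_subdiff (phi1 \+ phi2)%E xbar =
    singular_regular_subdiff phi1 xbar.
Proof.
move=> phi C D wbar; rewrite {}/phi in C *.
have /EFin_fin_numP[c2 phi2c] := calm_fin_num phi2_calm.
rewrite /= fin_numD => /andP[/EFin_fin_numP[c1 phi1c] _].
have phic : (phi1 \+ phi2)%E xbar = (c1 + c2)%:E by rewrite /= phi1c phi2c.
rewrite {}/wbar phi1c phi2c /= => qual; split; apply/seteqP; split=> zs.
- move=> /(regular_normal_epi_subdiff _ phic).
  move=> /(regular_normal_epi_sum phi1c phi2c qual)[u [v [uN vN ->]]].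
  exists u; first exact: (regular_normal_epi_subdiff u phi1c).1 uN.
  (* With [k = -1] the graph inequality is the subgradient inequality for [phi2]. *)
  exists v => //; apply/(regular_subdiffP _ phi2c).
  have [dv vS] := regular_normal_gph phi2_calm phi2c vN.
  split=> // eps eps0; have [g g0 gS] := vS _ eps0; exists g => // x xg.
  by have [y -> H] := gS _ xg; rewrite lee_fin; lra.
- by move=> [u uS [v vS <-]]; apply: (regular_subdiffD phi1c phi2c).
- rewrite /singular_regular_subdiff /= phi1c phi2c /= => -[dzs].
  move=> /(regular_normal_epi_sum phi1c phi2c qual)[u [v [uN vN uvE]]].
  suff v0 : v = 0 by rewrite uvE v0 addr0;
    split; [exact: (dual_pair u 0).1 uN.1 | exact: uN].
  (* With [k = 0] the values of [phi2] drop out, and [v] is normal to the whole space. *)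
  apply: (@regular_normal_setT _ _ xbar); apply/regular_normalP.
  have [dv vS] := regular_normal_gph phi2_calm phi2c vN.
  split=> // eps eps0; have [g g0 gS] := vS _ eps0; exists g => // x xg _.
  by have [y _] := gS _ xg; rewrite mul0r addr0.
- rewrite /singular_regular_subdiff /= phi1c phi2c /= => -[dzs zsN].
  by split; [exact: dzs | exact: singular_regular_normal_epi_sum].
Qed.
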